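(* Let $X$ be a locally compact Hausdorff space, let $U$ be a $\sigma$-compact open subset of $X$, and let $M$ be a countably generated Hilbert $C_0(X)$-module such that $M|_U\cong\ell_2(U)$. Then $M\cong M\oplus\ell_2(U)$.
   Context: $M|_U:=MC_0(U)$. $\ell_2(U)$ denotes the standard Hilbert module $\ell_2(C_0(U))\cong C_0(U,\ell_2(\mathbb N))$, regarded as a Hilbert $C_0(X)$-module (a submodule of $C_0(X,\ell_2(\mathbb N))$). $\cong$ is isomorphism of Hilbert $C_0(X)$-modules. *)

(* Defs.v *)
From mathcomp Require Import all_boot all_order all_algebra.
From mathcomp Require Import all_classical all_reals all_analysis.
From mathcomp Require Export complex.
From Stdlib Require List.
Set Implicit Arguments. Unset Strict Implicit. Unset Printing Implicit Defensive.
Import Order.TTheory GRing.Theory Num.Theory numFieldNormedType.Exports.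
Local Open Scope ring_scope.
Local Open Scope classical_set_scope.
Local Open Scope complex_scope.

Definition C0 {R : realType} {X : topologicalType} (f : X -> R[i]) : Prop :=
  continuous (fun x => complex.Re (f x) : R) /\
  continuous (fun x => complex.Im (f x) : R) /\
  forall eps : R, 0 < eps ->
    exists K : set X, compact K /\ forall x, ~ K x -> `|f x| < eps%:C.

(* f belongs to C_0(U), viewed inside C_0(X) (U open): f in C_0(X), f = 0 off U *)
Definition C0_on {R : realType} {X : topologicalType} (U : set X)
  (f : X -> R[i]) : Prop :=
  C0 f /\ forall x, ~ U x -> f x = 0.

(* ||x||^2 <= eps, where ||x||^2 = sup_t <x,x>(t) *)
Definition ip_small {R : realType} {X : topologicalType} {M : Type}
  (ip : M -> M -> X -> R[i]) (x : M) (eps : R) : Prop :=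
  forall t, complex.Re (ip x x t) <= eps.

(* Hilbert C_0(X)-module structure on the complex vector space M:
   right module action [act f m = m f] of C_0(X) and C_0(X)-valued inner
   product [ip], linear in the second variable, complete in the norm
   ||x|| = ||<x,x>||_oo^(1/2). *)
Record hilbert_C0_module {R : realType} {X : topologicalType}
  (M : lmodType R[i]) (act : (X -> R[i]) -> M -> M)
  (ip : M -> M -> X -> R[i]) : Prop := {
  hm_ip_C0 : forall x y, C0 (ip x y);
  hm_ip_lin : forall (a : R[i]) x y z t,
      ip x (a *: y + z) t = a * ip x y t + ip x z t;
  hm_ip_sym : forall x y t, ip y x t = (ip x y t)^*;
  hm_ip_pos : forall x t, 0 <= ip x x t;
  hm_ip_def : forall x, (forall t, ip x x t = 0) -> x = 0;
  hm_act_ip : forall f x y t, C0 f -> ip x (act f y) t = ip x y t * f t;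
  hm_act_lin : forall f (a : R[i]) y z, C0 f ->
      act f (a *: y + z) = a *: act f y + act f z;
  hm_act_add : forall f g y, C0 f -> C0 g ->
      act (fun t => f t + g t) y = act f y + act g y;
  hm_act_mul : forall f g y, C0 f -> C0 g ->
      act (fun t => f t * g t) y = act g (act f y);
  hm_complete : forall u : nat -> M,
      (forall eps : R, 0 < eps -> exists N, forall n m, (N <= n)%N -> (N <= m)%N ->
         ip_small ip (u n - u m) eps) ->
      exists l : M, forall eps : R, 0 < eps -> exists N, forall n, (N <= n)%N ->
         ip_small ip (u n - l) eps
}.

Definition countably_generated {R : realType} {X : topologicalType}
  (M : lmodType R[i]) (act : (X -> R[i]) -> M -> M)
  (ip : M -> M -> X -> R[i]) : Prop :=
  exists g : nat -> M, forall (m : M) (eps : R), 0 < eps ->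
    exists s : seq ((X -> R[i]) * nat),
      (forall p, List.In p s -> C0 p.1) /\
      ip_small ip (m - \sum_(p <- s) act p.1 (g p.2)) eps.

(* m belongs to M|_U = M C_0(U), the closed linear span of the m f,
   f in C_0(U). *)
Definition in_restr {R : realType} {X : topologicalType}
  (M : lmodType R[i]) (act : (X -> R[i]) -> M -> M)
  (ip : M -> M -> X -> R[i]) (U : set X) (m : M) : Prop :=
  forall eps : R, 0 < eps ->
    exists s : seq ((X -> R[i]) * M),
      (forall p, List.In p s -> C0_on U p.1) /\
      ip_small ip (m - \sum_(p <- s) act p.1 p.2) eps.

(* a = (a_n)_n belongs to l_2(U) = l_2(C_0(U)): each a_n in C_0(U) and
   sum_n |a_n|^2 converges uniformly (i.e. in C_0(U)). *)
Definition l2U {R : realType} {X : topologicalType} (U : set X)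
  (a : nat -> X -> R[i]) : Prop :=
  (forall n, C0_on U (a n)) /\
  forall eps : R, 0 < eps -> exists N, forall N1 N2, (N <= N1)%N -> (N1 <= N2)%N ->
    forall t, \sum_(N1 <= n < N2) `|a n t| ^+ 2 <= eps%:C.

Definition l2_ip_is {R : realType} {X : topologicalType}
  (a b : nat -> X -> R[i]) (t : X) (v : R[i]) : Prop :=
  forall eps : R, 0 < eps -> exists N, forall N', (N <= N')%N ->
    `|\sum_(n < N') (a n t)^* * b n t - v| <= eps%:C.

Definition l2_lin {R : realType} {X : Type} (c : R[i]) (a b : nat -> X -> R[i])
  : nat -> X -> R[i] := fun n t => c * a n t + b n t.
Definition l2_act {R : realType} {X : Type} (a : nat -> X -> R[i]) (f : X -> R[i])
  : nat -> X -> R[i] := fun n t => a n t * f t.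

Definition restr_iso_l2 {R : realType} {X : topologicalType}
  (M : lmodType R[i]) (act : (X -> R[i]) -> M -> M)
  (ip : M -> M -> X -> R[i]) (U : set X) : Prop :=
  exists Psi : (nat -> X -> R[i]) -> M,
    (forall a, l2U U a -> in_restr act ip U (Psi a)) /\
    (forall m, in_restr act ip U m -> exists a, l2U U a /\ Psi a = m) /\
    (forall a b, l2U U a -> l2U U b -> Psi a = Psi b -> a = b) /\
    (forall a b t, l2U U a -> l2U U b -> l2_ip_is a b t (ip (Psi a) (Psi b) t)) /\
    (forall c a b, l2U U a -> l2U U b ->
          Psi (l2_lin c a b) = c *: Psi a + Psi b) /\
    (forall f a, C0 f -> l2U U a -> Psi (l2_act a f) = act f (Psi a)).

(* M ⊕ l_2(U) ≅ M as Hilbert C_0(X)-modules: a bijective, C-linear,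
   C_0(X)-linear, inner-product preserving map Phi : M ⊕ l_2(U) -> M,
   where <(m,a),(m',b)> = <m,m'> + <a,b>. *)
Definition sum_l2_iso {R : realType} {X : topologicalType}
  (M : lmodType R[i]) (act : (X -> R[i]) -> M -> M)
  (ip : M -> M -> X -> R[i]) (U : set X) : Prop :=
  exists Phi : M -> (nat -> X -> R[i]) -> M,
    (forall m, exists m0 a, l2U U a /\ Phi m0 a = m) /\
    (forall m m' a b, l2U U a -> l2U U b -> Phi m a = Phi m' b -> m = m' /\ a = b) /\
    (forall m m' a b t, l2U U a -> l2U U b ->
          l2_ip_is a b t (ip (Phi m a) (Phi m' b) t - ip m m' t)) /\
    (forall c m m' a b, l2U U a -> l2U U b ->
          Phi (c *: m + m') (l2_lin c a b) = c *: Phi m a + Phi m' b) /\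
    (forall f m a, C0 f -> l2U U a ->
          Phi (act f m) (l2_act a f) = act f (Phi m a)).

(* Main.v *)
(** Idea.  [M|_U] consists of the [m] with [<m, m> = 0] off [U].  Suppose there is
    an adjointable isometry [T : M|_U -> M].  Then [M] is the sum of [ker T^*]
    and a copy of [l_2(U)], and since [l_2(U) (+) l_2(U)] is isomorphic to [l_2(U)],
    adding another copy of [l_2(U)] changes nothing.

    To find [T], take an increasing approximate unit [p_0 = 0, p_1, p_2, ...] of [C_0(U)]
    which is eventually [1] on each compact subset of [U], and put
    [phi_n = sqrt (p_(n+1) - p_n)], so that [sum_n phi_n^2 = 1] on [U].  Let [E_n] be
    isometries of [l_2(U)] with orthogonal ranges, [E_n] sending the basis vector [e_j] to
    [e_(k_n(j))], and let [T = sum_n phi_n E_n].  Its adjoint should be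
    [T^* m = sum_n E_n^* (phi_n m)], but for [m] outside [M|_U] convergence is not
    automatic.  Each [phi_n m] lies in [M|_U = l_2(U)], so its coordinates have small tails:
    if the indices [k_n(j)] are large enough, [E_n^* (phi_n g_i)] is tiny for the first [n]
    generators [g_i], and convergence for all [m] follows because the partial sums
    are contractions.  This is where countable generation is used. *)

Require Import Defs.
From mathcomp Require Import all_boot all_order all_algebra.
From mathcomp Require Import all_classical all_reals all_analysis.
From mathcomp Require Import complex.
From mathcomp Require Import ring lra.
Set Implicit Arguments. Unset Strict Implicit. Unset Printing Implicit Defensive.
Import Order.TTheory GRing.Theory Num.Theory numFieldNormedType.Exports.
Local Open Scope ring_scope.
Local Open Scope classical_set_scope.
Local Open Scope complex_scope.

(** * Cutoff functions and approximate units *)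

Section Cutoffs.
Variables (R : realType) (X : topologicalType).
Implicit Types (U K : set X) (v : X -> R).

(* The last clause does not say that the support lies in [U]. *)
Definition cutoff U v :=
  [/\ continuous v, forall t, 0 <= v t, forall t, ~ U t -> v t = 0 &
      exists L : set X, compact L /\ forall t, ~ L t -> v t = 0].

Lemma cutoff0 U : cutoff U (cst 0).
Proof.
split=> // [t|]; first exact: cvg_cst.
by exists set0; split=> //; exact: compact0.
Qed.

Lemma cutoffD U v w : cutoff U v -> cutoff U w -> cutoff U (fun t => v t + w t).
Proof.
move=> [cv v0 vU [L [cL Lv]]] [cw w0 wU [L' [cL' Lw]]]; split=> [t|t|t Ut|].
- by apply: cvgD; [exact: cv | exact: cw].
- by rewrite addr_ge0.
- by rewrite vU // wU // addr0.
- exists (L `|` L'); split; first exact: compactU.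
  by move=> t /not_orP[nL nL']; rewrite Lv // Lw // addr0.
Qed.

Lemma cutoff_sum U (v : nat -> X -> R) n :
  (forall i, cutoff U (v i)) -> cutoff U (fun t => \sum_(0 <= i < n) v i t).
Proof.
move=> bv; elim: n => [|n IH].
  rewrite (_ : (fun _ => _) = cst 0); first exact: cutoff0.
  by apply/funext => t; rewrite big_nil.
rewrite (_ : (fun _ => _) = fun t => \sum_(0 <= i < n) v i t + v n t); first exact: cutoffD.
by apply/funext => t; rewrite big_nat_recr.
Qed.

Hypotheses (hX : hausdorff_space X) (lcX : locally_compact [set: X]).

(** Complete regularity separates [x] from the complement of the interior of [L] intersected with
    [U], where [L] is a compact neighbourhood of [x]. This gives vanishing off [U] and off [L] at
    once. *)
Lemma cutoff_point U x : open U -> U x -> exists v, cutoff U v /\ 1 < v x.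
Proof.
move=> oU Ux; have [L] := @lcX x I.
rewrite withinET => nLx [cL clL].
set B := ~` (L^° `&` U).
have oLU : open (L^° `&` U) by apply: openI => //; exact: open_interior.
have nBx : ~ B x.
  rewrite /B; apply; split => //.
have /(uniform_separatorP (R := R))[f [cf f01 fx fB]] :=
  locally_compact_completely_regular (R := R) lcX hX (open_closedC oLU) nBx.
have f0 : f x = 0 by apply: fx; exists x.
have f1 t : B t -> f t = 1 by move=> Bt; apply: fB; exists t.
(* The factor 2 gives the value 2 at [x]: the strict bound [1 < v] persists nearby, and truncation
   at 1 will then give exactly 1. *)
exists (fun t => 2 * (1 - f t)); split; last by rewrite f0; lra.
split=> [t|t|t Ut|].
- by apply: cvgM; [exact: cvg_cst | apply: cvgB; [exact: cvg_cst | exact: cf]].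
- have /f01 : range f (f t) by exists t.
  by rewrite /= in_itv /= => /andP[_ ?]; lra.
- by rewrite f1; [lra | case].
- exists L; split => // t Lt; rewrite f1; first lra.
  by case=> /interior_subset.
Qed.

(** Cutoffs are directed by pointwise domination, with sums as upper bounds. Compactness, as a
    near-covering property for the resulting filter, replaces the choice of a finite subcover. *)
Lemma cutoff_compact U K : open U -> compact K -> K `<=` U ->
  exists v, cutoff U v /\ forall t, K t -> 1 < v t.
Proof.
move=> oU cK KU.
pose F := filter_from (cutoff U) (fun v => [set w | cutoff U w /\ forall t, v t <= w t]).
have FF : Filter F.
  apply: filter_from_filter; first by exists (cst 0); exact: cutoff0.
  move=> v w bv bw; exists (fun t => v t + w t); first exact: cutoffD.
  have [[_ v0 _ _] [_ w0 _ _]] := (bv, bw).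
  move=> z [bz vwz]; split; split=> // t; apply: le_trans (vwz t).
    by rewrite lerDl.
  by rewrite lerDr.
have /compact_near_coveringP/(_ _ F (fun w t => 1 < w t) FF) := cK.
case=> [x /KU Ux|v bv vK]; last by exists v; split=> // t Kt; apply: vK Kt.
have [v [bv vx]] := cutoff_point oU Ux; have [cv _ _ _] := bv.
exists ([set t | 1 < v t], [set w | cutoff U w /\ forall t, v t <= w t]).
  split; last by exists v.
  by apply: (cv x [set r : R | 1 < r]); apply: open_nbhs_nbhs; split=> //; exact: open_gt.
by move=> [t w] /= [vt [_ vw]]; apply: lt_le_trans (vw t).
Qed.

Lemma approx_unit U : open U ->
  (exists K : nat -> set X, (forall n, compact (K n)) /\ U = \bigcup_n K n) ->
  exists p : nat -> X -> R,
    [/\ forall n, cutoff U (p n), forall t, p 0%N t = 0,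
        forall n t, p n t <= p n.+1 t, forall n t, p n t <= 1 &
        forall C, compact C -> C `<=` U ->
          exists N, forall n t, (N <= n)%N -> C t -> p n t = 1].
Proof.
move=> oU [K [cK UK]].
have /choice[v bv] : forall n, exists v, cutoff U v /\ forall t, K n t -> 1 < v t.
  by move=> n; apply: cutoff_compact => //; rewrite UK; exact: bigcup_sup.
pose s n t := \sum_(0 <= i < n) v i t.
have bs n : cutoff U (s n) by apply: cutoff_sum => i; case: (bv i).
have sS n t : s n t <= s n.+1 t.
  by rewrite /s big_nat_recr //= lerDl; case: (bv n) => -[].
have smono m n t : (m <= n)%N -> s m t <= s n t.
  by move=> /subnK <-; elim: (n - m)%N => // k IH; exact: le_trans IH (sS _ _).
(* The sum [s 0] is empty, whence [p_0 = 0]; [s n.+1] is the first sum containing [v n], so it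
   exceeds 1 on [K n]. *)
exists (fun n t => Num.min 1 (s n t)); split.
- move=> n; have [cs s0 sU [L [cL Ls]]] := bs n; split=> [t|t|t Ut|].
  + apply: (@continuous_min _ _ (cst 1) (s n)); [exact: cvg_cst | exact: cs].
  + by rewrite le_min ler01 s0.
  + by rewrite sU // min_r.
  + by exists L; split=> // t Lt; rewrite Ls // min_r.
- by move=> t; rewrite /s big_nil min_r.
- by move=> n t; rewrite le_min !ge_min lexx /= sS orbT.
- by move=> n t; rewrite ge_min lexx.
- move=> C cC CU.
  (* Near a point of [K n] all [s m] with [m > n] exceed 1 on one common neighbourhood; compactness
     of [C] makes the threshold uniform. *)
  have /compact_near_coveringP/(_ _ \oo (fun n t => 1 < s n t) _) := cC.
  case=> [t /CU|N _ NC]; last first.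
    by exists N => n t Nn Ct; rewrite min_l //; apply/ltW/(NC n).
  rewrite UK => -[n _ Kt].
  have [[cs s0 _ _] [_ vK]] := (bs n.+1, bv n).
  exists ([set u | 1 < s n.+1 u], [set m | (n < m)%N]).
    split; last by exists n.+1.
    apply: (cs t [set r : R | 1 < r]); apply: open_nbhs_nbhs; split; first exact: open_gt.
    have := vK _ Kt; have [_ /(_ t)] := bs n.
    by rewrite /s big_nat_recr //=; lra.
  by move=> [u m] /= [su nm]; apply: lt_le_trans (smono _ _ _ nm).
Qed.

End Cutoffs.

(** * Functions vanishing at infinity *)

Section C0Functions.
Variables (R : realType) (X : topologicalType) (U : set X).

Lemma C0_cutoff (v : X -> R) : cutoff U v -> C0_on U (fun t => (v t)%:C).
Proof.
move=> [cv v0 vU [L [cL Lv]]]; split=> [|t Ut]; last by rewrite vU.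
split; first exact: cv.
split; first by move=> t; exact: cvg_cst.
move=> e e0; exists L; split=> // t Lt; rewrite Lv // normr0.
by rewrite (ltcR 0 e).
Qed.

Lemma C0_bounded (f : X -> R[i]) : C0 f ->
  exists2 B : R, 0 < B & forall t, `|f t| ^+ 2 <= B%:C.
Proof.
move=> [cRe [cIm fK]]; have [K [cK Kf]] := fK 1 ltr01.
pose g t := complex.Re (f t) ^+ 2 + complex.Im (f t) ^+ 2.
have gE t : `|f t| ^+ 2 = (g t)%:C by rewrite add_Re2_Im2.
have out t : ~ K t -> g t <= 1.
  move=> /Kf; rewrite -(lecR (g t)) -gE => ft.
  by rewrite expr_le1 // ltW.
(* The extreme value theorem needs a point of [K]. *)
have [K0|/set0P K0] := eqVneq K set0.
  exists 1 => // t; rewrite gE lecR; apply: out; by rewrite K0.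
have cg : continuous g.
  move=> t; apply: (@continuousD _ _ _ (fun t => complex.Re (f t) ^+ 2)
    (fun t => complex.Im (f t) ^+ 2));
    apply: (@continuous_comp _ _ _ _ (fun r : R => r ^+ 2)); try exact: exprn_continuous.
    exact: cRe.
  exact: cIm.
have [c _ gc] := compact_EVT_max K0 cK (continuous_subspaceT cg).
have g0 : 0 <= g c by rewrite addr_ge0 ?sqr_ge0.
exists (1 + g c); first by lra.
move=> t; rewrite gE lecR; have [Kt|Kt] := pselect (K t).
  by have := gc t (mem_set Kt); lra.
by have := out _ Kt; lra.
Qed.

(** The part of [K] where [Re f >= eps] is a compact subset of [U], so [p n] is eventually 1 on it.
    Applied to [f = <x, x>], this gives the uniform estimates for [p n x] and for the partial sums
    of [T]. *)
Lemma C0_on_small (p : nat -> X -> R) (f : X -> R[i]) :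
  (forall C, compact C -> C `<=` U ->
     exists N, forall n t, (N <= n)%N -> C t -> p n t = 1) ->
  C0_on U f -> forall eps : R, 0 < eps ->
  exists N, forall n t, (N <= n)%N -> p n t < 1 -> complex.Re (f t) < eps.
Proof.
move=> pC [[cRe [_ fK]] fU] e e0; have [K [cK Kf]] := fK e e0.
have [||N Np] := pC (K `&` [set t | e <= complex.Re (f t)]).
- apply: compact_closedI => //.
  apply: (preimage_closed (f := fun t => complex.Re (f t)) (D := [set r | e <= r])).
    by move=> t _; exact: cRe.
  exact: closed_ge.
- move=> t [_ /= et]; apply: contrapT => /fU ft0.
  by move: et; rewrite ft0 leNgt e0.
exists N => n t Nn pt; rewrite ltNge; apply/negP => et.
have [Kt|/Kf ft] := pselect (K t).
  by move: pt; rewrite (Np n t) ?ltxx.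
have := le_lt_trans (normc_ge_Re (f t)) ft; rewrite ltcR => ne.
by have := le_lt_trans (ler_norm _) ne; rewrite ltNge et.
Qed.

End C0Functions.

(** * Square-summable sequences *)

Section Reindexing.
Variable k : nat -> nat.
Hypothesis kmono : {homo k : i j / (i < j)%N}.

Lemma incr_leq i j : (i <= j)%N -> (k i <= k j)%N.
Proof. by rewrite leq_eqVlt => /predU1P[->//|/kmono/ltnW]. Qed.

Lemma incr_ge_id i : (i <= k i)%N.
Proof. by elim: i => // i IH; apply: leq_ltn_trans IH (kmono _). Qed.

Lemma incr_inj : injective k.
Proof.
move=> i j eqk; case: (ltngtP i j) => // /kmono; by rewrite eqk ltnn.
Qed.

Lemma sum_reindex_off (V : nmodType) (F : nat -> V) N1 N2 :
  (forall m, (forall j, k j <> m) -> F m = 0) -> (N1 <= N2)%N ->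
  \sum_(k N1 <= m < k N2) F m = \sum_(N1 <= j < N2) F (k j).
Proof.
move=> F0 /subnK <-; elim: (N2 - N1)%N => [|n IH]; first by rewrite !big_geq.
have lek : (k N1 <= k (n + N1))%N by apply: incr_leq; rewrite leq_addl.
have ltk : (k (n + N1) < k (n.+1 + N1))%N by exact: kmono.
rewrite (big_cat_nat lek (ltnW ltk)) /= IH addSn big_nat_recr ?leq_addl //=.
(* Between two consecutive values of [k], only the first index of the block lies in the range of
   [k]. *)
congr (_ + _); rewrite big_ltn // big_nat_cond big1 ?addr0 // => m /andP[/andP[m1 m2] _].
apply: F0 => j kjm; move: m1 m2; rewrite -kjm.
case: (ltngtP (n + N1) j) => [/incr_leq h _|jn|->]; last by rewrite ltnn.
  by rewrite ltnNge h.
by have := kmono jn; move=> h1 h2; move: (ltn_trans h1 h2); rewrite ltnn.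
Qed.

Lemma sum_reindex_le (R : numDomainType) (F : nat -> R) N1 N2 :
  (forall m, 0 <= F m) -> (N1 <= N2)%N ->
  \sum_(N1 <= j < N2) F (k j) <= \sum_(k N1 <= m < k N2) F m.
Proof.
(* [G] vanishes off the range of [k], so exact reindexing applies to it, and [G <= F]. *)
move=> F0 N12; pose G m := if `[< exists j, k j = m >] then F m else 0.
rewrite (eq_bigr (fun j => G (k j))) => [|j _]; last first.
  by rewrite /G asboolT //; exists j.
rewrite -sum_reindex_off // => [|m off].
  by apply: ler_sum => m _; rewrite /G; case: asboolP.
by rewrite /G asboolF // => -[j] /off.
Qed.

End Reindexing.

Section Sequences.
Variables (R : realType) (X : topologicalType) (U : set X).
Implicit Types (a b c : nat -> X -> R[i]) (k l : nat -> nat).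

Definition pull k a : nat -> X -> R[i] := fun j => a (k j).

(* The adjoint isometry of [pull k]: it sends the [j]-th basis vector to the [k j]-th. *)
Definition push k a : nat -> X -> R[i] :=
  fun m => if [pick j : 'I_m.+1 | k j == m] is Some j then a j else cst 0.

(** Since [j <= k j], the bounded search in [push] misses no preimage. *)
Lemma push_image k a j : {homo k : i j / (i < j)%N} -> push k a (k j) = a j.
Proof.
move=> kk; rewrite /push; case: pickP => [i /eqP/(incr_inj kk) -> //|].
have jk : (j < (k j).+1)%N by rewrite ltnS incr_ge_id.
by move=> /(_ (Ordinal jk)); rewrite /= eqxx.
Qed.

Lemma push_off k a m : (forall j, k j <> m) -> push k a m = cst 0.
Proof. by move=> off; rewrite /push; case: pickP => // j /eqP/off. Qed.

Lemma pull_push k a : {homo k : i j / (i < j)%N} -> pull k (push k a) = a.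
Proof. by move=> kk; apply/funext => j; rewrite /pull push_image. Qed.

Lemma pull_push_disjoint k l a : (forall i j, k i <> l j) ->
  pull k (push l a) = fun _ => cst 0.
Proof.
by move=> kl; apply/funext => j; rewrite /pull push_off // => i /esym/kl.
Qed.

(** This is the resolution [E_0 E_0^* + E_1 E_1^* = 1] behind the isomorphism of [l_2(U) (+) l_2(U)]
    with [l_2(U)]. *)
Lemma push_even_odd a :
  l2_lin 1 (push (fun j => j.*2) (pull (fun j => j.*2) a))
           (push (fun j => j.*2.+1) (pull (fun j => j.*2.+1) a)) = a.
Proof.
have ke : {homo (fun j => j.*2) : i j / (i < j)%N} by move=> i j; rewrite ltn_double.
have ko : {homo (fun j => j.*2.+1) : i j / (i < j)%N} by move=> i j; rewrite ltnS ltn_double.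
apply/funext => m; apply/funext => t; rewrite /l2_lin mul1r.
rewrite -(odd_double_half m); case: (odd m) => /=; rewrite ?add1n ?add0n.
  rewrite (push_image _ _ ko) push_off ?add0r // => j /(congr1 odd).
  by rewrite /= !odd_double.
rewrite (push_image _ _ ke) push_off ?addr0 // => j /(congr1 odd).
by rewrite /= !odd_double.
Qed.

Lemma C0_on0 : C0_on U (cst 0 : X -> R[i]).
Proof.
exact: (C0_cutoff (cutoff0 R U)).
Qed.

Lemma l2U_pull k a : {homo k : i j / (i < j)%N} -> l2U U a -> l2U U (pull k a).
Proof.
move=> kk [aU aS]; split=> [n|e /aS[N aN]]; first exact: aU.
exists N => N1 N2 NN1 N12 t.
apply: le_trans (aN (k N1) (k N2) _ _ t).
- by apply: (sum_reindex_le kk (F := fun n => `|a n t| ^+ 2)) => // m; exact: exprn_ge0.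
- by apply: leq_trans NN1 _; exact: incr_ge_id.
- exact: incr_leq.
Qed.

Lemma l2U_push k a : {homo k : i j / (i < j)%N} -> l2U U a -> l2U U (push k a).
Proof.
move=> kk [aU aS]; split=> [m|e /aS[N aN]].
  by rewrite /push; case: pickP => [j _|_]; [exact: aU | exact: C0_on0].
(* From [k N] on, the window from [N1] to [N2] sits inside that from [k N] to [k N2], whose sum is
   the sum of [a] from [N] to [N2]. *)
exists (k N) => N1 N2 NN1 N12 t.
have Nk : (N1 <= k N2)%N by apply: leq_trans N12 (incr_ge_id kk _).
have NN2 : (N <= N2)%N.
  rewrite leqNgt; apply/negP => /kk h.
  by have := leq_trans NN1 (leq_trans N12 (incr_ge_id kk N2)); rewrite leqNgt h.
apply: le_trans (aN N N2 (leqnn _) NN2 t).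
rewrite [leRHS](eq_bigr (fun n => `|push k a (k n) t| ^+ 2)) => [|n _]; last first.
  by rewrite push_image.
rewrite -(sum_reindex_off kk (F := fun n => `|push k a n t| ^+ 2)) // => [|m off]; last first.
  by rewrite push_off //= normr0 expr0n.
rewrite [leRHS](big_cat_nat NN1 Nk) /=.
rewrite [X in _ <= _ + X](big_cat_nat N12 (incr_ge_id kk N2)) /=.
rewrite addrCA lerDl addr_ge0 // sumr_ge0 // => m _; exact: exprn_ge0.
Qed.

(** The first [k N'] terms of one series add up to the first [N'] terms of the other. *)
Lemma l2_ip_push k a b t v : {homo k : i j / (i < j)%N} ->
  l2_ip_is (push k a) b t v -> l2_ip_is a (pull k b) t v.
Proof.
move=> kk ab e /ab[N abN]; exists N => N' NN'.
have := abN (k N') (leq_trans NN' (incr_ge_id kk N')).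
suff -> : \sum_(n < k N') (push k a n t)^* * b n t =
    \sum_(n < N') (a n t)^* * pull k b n t by [].
pose F n := (push k a n t)^* * b n t.
have F0 m : (forall j, k j <> m) -> F m = 0.
  by move=> off; rewrite /F push_off //= rmorph0 mul0r.
rewrite -(big_mkord xpredT F) (big_cat_nat (leq0n (k 0)) (incr_leq kk (leq0n N'))) /=.
rewrite big_nat_cond big1 ?add0r => [|m /andP[/andP[_ mk] _]]; last first.
  by apply: F0 => j kj; move: (incr_leq kk (leq0n j)); rewrite leqNgt kj mk.
rewrite (sum_reindex_off kk F0) // big_mkord.
by apply: eq_bigr => j _; rewrite /F push_image.
Qed.

Lemma l2_ip_unique a b t v w : l2_ip_is a b t v -> l2_ip_is a b t w -> v = w.
Proof.
move=> av aw; apply/eqP; rewrite -subr_eq0 -normr_eq0; apply: contraT => vw0.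
have [r rE] : exists r : R, `|v - w| = r%:C by rewrite normc_def; eexists.
have r0 : 0 < r.
  by have : 0 < `|v - w| by [rewrite lt_neqAle eq_sym vw0 normr_ge0]; rewrite rE (ltcR 0).
have r3 : 0 < r / 3 by rewrite divr_gt0.
have [[N1 h1] [N2 h2]] := (av _ r3, aw _ r3).
have {}h1 := h1 (maxn N1 N2) (leq_maxl _ _).
have {}h2 := h2 (maxn N1 N2) (leq_maxr _ _).
have := ler_distD (\sum_(n < maxn N1 N2) (a n t)^* * b n t) v w.
rewrite rE distrC => h3.
have := le_trans h3 (lerD h1 h2); rewrite -[_ + _](rmorphD (real_complex R)) lecR.
by move=> h; exfalso; move: h r0; clear; lra.
Qed.

(** A reindexing with all values at least [d] sees only the tail of [a]. The bound [d] is uniform in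
    [k], which is chosen after it, and in [t], because the norm is a supremum. *)
Lemma l2_ip_pull_small a (e : R) : 0 < e -> l2U U a ->
  exists d, forall k t v, {homo k : i j / (i < j)%N} -> (forall j, d <= k j)%N ->
    l2_ip_is (pull k a) (pull k a) t v -> complex.Re v <= e.
Proof.
move=> e0 [_ aS]; have e2 : 0 < e / 2 by rewrite divr_gt0.
have [d ad] := aS _ e2; exists d => k t v kk dk av.
have [N /(_ _ (leqnn N)) vN] := av _ e2.
have {ad} := ad (k 0)%N (k N) (dk _) (incr_leq kk (leq0n N)) t.
have a0 n : 0 <= `|a n t| ^+ 2 by exact: exprn_ge0.
move=> /(le_trans (sum_reindex_le kk a0 (leq0n N))).
rewrite big_mkord.
have -> : \sum_(n < N) `|a (k n) t| ^+ 2 = \sum_(n < N) (pull k a n t)^* * pull k a n t.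
  by apply: eq_bigr => n _; rewrite normCK mulrC.
move: vN; set s := \sum_(n < N) _ => vN; rewrite lecE => /andP[_ /= sE].
have := le_trans (normc_ge_Re (s - v)) vN; rewrite lecR => svE.
have := le_trans (ler_norm _) (eq_ind_r (fun z => z <= e / 2) svE (normrN _)).
have -> : - complex.Re (s - v) = complex.Re v - complex.Re s.
  by case: (s) (v) => [? ?] [? ?] /=; rewrite opprB.
by move: sE; lra.
Qed.

End Sequences.

(** * Hilbert modules and adjoint pairs *)

Lemma eq0_of_small (R : realType) (z : R[i]) (c : R) : 0 <= c ->
  (forall e : R, 0 < e -> `|z| ^+ 2 <= (e * c)%:C) -> z = 0.
Proof.
move=> c0 zc; apply/eqP; rewrite -normr_eq0 -sqrf_eq0; apply/eqP/le_anti.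
rewrite exprn_ge0 // andbT; rewrite -add_Re2_Im2 in zc *.
rewrite (lecR _ 0); apply/ler_addgt0Pl => e e0; rewrite addr0.
(* Dividing by [1 + c] covers the case [c = 0]. *)
have /zc : 0 < e / (1 + c) by rewrite divr_gt0 //; lra.
rewrite lecR => /le_trans; apply.
rewrite -mulrA; apply: ler_piMr; first exact: ltW.
by rewrite mulrC ler_pdivrMr ?mul1r; lra.
Qed.

Section HilbertModule.
Variables (R : realType) (X : topologicalType) (M : lmodType R[i]).
Variables (act : (X -> R[i]) -> M -> M) (ip : M -> M -> X -> R[i]).
Hypothesis H : hilbert_C0_module act ip.
Implicit Types (x y z : M) (t : X) (e : R).

Definition sqnorm x t : R := complex.Re (ip x x t).

Lemma ip_sqnorm x t : ip x x t = (sqnorm x t)%:C.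
Proof. by rewrite /sqnorm RRe_real // ger0_real // (hm_ip_pos H). Qed.

Lemma sqnorm_ge0 x t : 0 <= sqnorm x t.
Proof. by rewrite -lecR -ip_sqnorm (hm_ip_pos H). Qed.

Lemma ipDr x y z t : ip x (y + z) t = ip x y t + ip x z t.
Proof. by have := hm_ip_lin H 1 x y z t; rewrite scale1r mul1r. Qed.

Lemma ip0r x t : ip x 0 t = 0.
Proof. by have /eqP := ipDr x 0 0 t; rewrite addr0 -subr_eq subrr => /eqP. Qed.

Lemma ipZr (a : R[i]) x y t : ip x (a *: y) t = a * ip x y t.
Proof. by have := hm_ip_lin H a x y 0 t; rewrite ip0r !addr0. Qed.

Lemma ipNr x y t : ip x (- y) t = - ip x y t.
Proof. by rewrite -scaleN1r ipZr mulN1r. Qed.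

Lemma ipBr x y z t : ip x (y - z) t = ip x y t - ip x z t.
Proof. by rewrite ipDr ipNr. Qed.

Lemma ip_sumr x (I : Type) (s : seq I) (F : I -> M) t :
  ip x (\sum_(i <- s) F i) t = \sum_(i <- s) ip x (F i) t.
Proof. by elim: s => [|i s IH]; rewrite ?big_nil ?ip0r // !big_cons ipDr IH. Qed.

Lemma ipDl x y z t : ip (x + y) z t = ip x z t + ip y z t.
Proof. by rewrite (hm_ip_sym H) ipDr rmorphD /= -!(hm_ip_sym H). Qed.

Lemma ip0l x t : ip 0 x t = 0.
Proof. by rewrite (hm_ip_sym H) ip0r rmorph0. Qed.

Lemma ipZl (a : R[i]) x y t : ip (a *: x) y t = a^*%C * ip x y t.
Proof. by rewrite (hm_ip_sym H) ipZr rmorphM /= -(hm_ip_sym H). Qed.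

Lemma ipNl x y t : ip (- x) y t = - ip x y t.
Proof. by rewrite (hm_ip_sym H) ipNr rmorphN /= -(hm_ip_sym H). Qed.

Lemma ipBl x y z t : ip (x - y) z t = ip x z t - ip y z t.
Proof. by rewrite ipDl ipNl. Qed.

Lemma ip_suml (I : Type) (s : seq I) (F : I -> M) x t :
  ip (\sum_(i <- s) F i) x t = \sum_(i <- s) ip (F i) x t.
Proof. by elim: s => [|i s IH]; rewrite ?big_nil ?ip0l // !big_cons ipDl IH. Qed.

Lemma ip_actr f x y t : C0 f -> ip x (act f y) t = ip x y t * f t.
Proof. exact: (hm_act_ip H). Qed.

Lemma ip_actl f x y t : C0 f -> ip (act f x) y t = (f t)^*%C * ip x y t.
Proof.
by move=> cf; rewrite (hm_ip_sym H) ip_actr // rmorphM /= -(hm_ip_sym H) mulrC.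
Qed.

Lemma Re_ipC x y t : complex.Re (ip y x t) = complex.Re (ip x y t).
Proof. by rewrite (hm_ip_sym H); case: (ip x y t). Qed.

Lemma sqnormD x y t :
  sqnorm (x + y) t = sqnorm x t + sqnorm y t + 2 * complex.Re (ip x y t).
Proof.
rewrite /sqnorm ipDl !ipDr !raddfD /= (Re_ipC x y).
by rewrite mulr_natl mulr2n; ring.
Qed.

Lemma sqnormN x t : sqnorm (- x) t = sqnorm x t.
Proof. by rewrite /sqnorm ipNl ipNr opprK. Qed.

Lemma sqnormB x y t :
  sqnorm (x - y) t = sqnorm x t + sqnorm y t - 2 * complex.Re (ip x y t).
Proof. by rewrite sqnormD sqnormN ipNr raddfN mulrN. Qed.

Lemma sqnorm_act f x t : C0 f ->
  (sqnorm (act f x) t)%:C = `|f t| ^+ 2 * (sqnorm x t)%:C.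
Proof. by move=> cf; rewrite -!ip_sqnorm ip_actl // ip_actr // sqr_normc; ring. Qed.

Lemma sqnormD_le x y t : sqnorm (x + y) t <= 2 * sqnorm x t + 2 * sqnorm y t.
Proof. by have := sqnorm_ge0 (x - y) t; rewrite sqnormB sqnormD; lra. Qed.

(* Cauchy-Schwarz, with [e] replacing the possibly zero [sqnorm x t]. *)
Lemma ip_le_sqnorm x y t e : 0 < e -> sqnorm x t <= e ->
  `|ip x y t| ^+ 2 <= (e * sqnorm y t)%:C.
Proof.
move=> e0 xe; set b := ip x y t.
pose n : R := complex.Re b ^+ 2 + complex.Im b ^+ 2.
have nE : `|b| ^+ 2 = n%:C by rewrite add_Re2_Im2.
have n0 : 0 <= n by rewrite addr_ge0 ?sqr_ge0.
(* With this [l], expanding [sqnorm (y - l x) >= 0] and using [sqnorm x <= e] leaves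
   [n / e <= sqnorm y]. *)
pose l : R[i] := (e^-1)%:C * b.
have q0 := sqnorm_ge0 (y - l *: x) t.
have lyE : complex.Re (ip y (l *: x) t) = e^-1 * n.
  rewrite ipZr (hm_ip_sym H x y) -/b /l -mulrA -sqr_normc nE.
  by rewrite -[_%:C * _](rmorphM (real_complex R)).
have lxE : sqnorm (l *: x) t = e^-2 * n * sqnorm x t.
  apply: complexI; rewrite -ip_sqnorm ipZl ipZr ip_sqnorm mulrA [_^*%C * _]mulrC -sqr_normc.
  rewrite /l normrM exprMn nE.
  have -> : `|(e^-1)%:C| ^+ 2 = (e^-2)%:C.
    by rewrite sqr_normc conjc_real -[_ * _](rmorphM (real_complex R)) -expr2 exprVn.
  by rewrite -!(rmorphM (real_complex R)).
move: q0; rewrite sqnormB lyE lxE nE lecR => q0.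
have : e^-2 * n * sqnorm x t <= e^-1 * n.
  rewrite -exprVn expr2 -!mulrA ler_pM2l ?invr_gt0 //.
  by rewrite mulrCA ler_piMr // mulrC ler_pdivrMr // mul1r.
move=> h; have : e^-1 * n <= sqnorm y t by lra.
by rewrite mulrC ler_pdivrMr // mulrC.
Qed.

Lemma ip_eq0 x y t : ip x x t = 0 -> ip x y t = 0.
Proof.
move=> x0; apply: (eq0_of_small (sqnorm_ge0 y t)) => e e0.
by apply: ip_le_sqnorm => //; rewrite /sqnorm x0 /= ltW.
Qed.

Definition lim_to (u : nat -> M) (l : M) := forall e, 0 < e ->
  exists N, forall n, (N <= n)%N -> ip_small ip (u n - l) e.

Lemma cauchy_lim (u : nat -> M) :
  (forall e, 0 < e -> exists N, forall n m, (N <= n)%N -> (n <= m)%N ->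
     forall t, sqnorm (u m - u n) t <= e) ->
  exists l, lim_to u l.
Proof.
move=> uC; apply: (hm_complete H) => e /uC[N uN]; exists N => n m Nn Nm t.
have [nm|/ltnW mn] := leqP n m; last exact: uN.
by rewrite -[X in X <= _]/(sqnorm _ _) -sqnormN opprB; exact: uN.
Qed.

(** Eventually constant inner products suffice below, because at a fixed [t] only finitely many
    [phi_n] are nonzero. *)
Lemma ip_lim (u : nat -> M) l y t (v : R[i]) : lim_to u l ->
  (exists N, forall n, (N <= n)%N -> ip (u n) y t = v) -> ip l y t = v.
Proof.
move=> ul [N uN]; apply/eqP; rewrite -subr_eq0; apply/eqP.
apply: (eq0_of_small (sqnorm_ge0 y t)) => e e0; have [N' ulN] := ul e e0.
rewrite -(uN (maxn N N') (leq_maxl _ _)) -ipBl -normrN -ipNl opprB.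
by apply: ip_le_sqnorm => //; exact: ulN (leq_maxr _ _) t.
Qed.

Record submod (D : M -> Prop) : Prop := {
  submod_lin : forall (a : R[i]) x y, D x -> D y -> D (a *: x + y);
  submod_act : forall f x, C0 f -> D x -> D (act f x) }.

Lemma submodB D x y : submod D -> D x -> D y -> D (x - y).
Proof. by move=> sD Dx Dy; rewrite addrC -scaleN1r; exact: submod_lin. Qed.

Lemma submod_full : submod (fun _ => True). Proof. by []. Qed.

Lemma submod_ext (D : M -> Prop) x y : submod D -> D x -> D y ->
  (forall z t, D z -> ip x z t = ip y z t) -> x = y.
Proof.
move=> sD Dx Dy xy; apply/eqP; rewrite -subr_eq0; apply/eqP/(hm_ip_def H) => t.
by rewrite ipBl xy ?subrr //; exact: submodB.
Qed.

(** Maps between submodules are total functions on [M], constrained only on their domains. Linearity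
    over scalars and over [C_0(X)] is not assumed: it follows from the adjoint relation. *)
Definition adjoint (D1 D2 : M -> Prop) (A B : M -> M) :=
  [/\ forall x, D1 x -> D2 (A x), forall y, D2 y -> D1 (B y) &
      forall x y t, D1 x -> D2 y -> ip (A x) y t = ip x (B y) t].

Lemma adjointC D1 D2 A B : adjoint D1 D2 A B -> adjoint D2 D1 B A.
Proof.
by move=> [A1 B2 AB]; split=> // x y t Dx Dy; rewrite (hm_ip_sym H) -AB // -(hm_ip_sym H).
Qed.

Lemma adjoint_lin D1 D2 A B (a : R[i]) x y : submod D1 -> submod D2 ->
  adjoint D1 D2 A B -> D1 x -> D1 y -> A (a *: x + y) = a *: A x + A y.
Proof.
move=> s1 s2 [A1 B2 AB] Dx Dy.
have [sx sy] := (A1 x Dx, A1 y Dy); have Dxy := submod_lin s1 a Dx Dy.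
apply: (submod_ext s2) => [||z t Dz]; [exact: A1 | exact: submod_lin |].
by rewrite AB // !ipDl !ipZl !AB.
Qed.

Lemma adjoint_act D1 D2 A B f x : submod D1 -> submod D2 ->
  adjoint D1 D2 A B -> C0 f -> D1 x -> A (act f x) = act f (A x).
Proof.
move=> s1 s2 [A1 B2 AB] cf Dx.
have Dfx := submod_act s1 cf Dx; have sAx := A1 x Dx.
apply: (submod_ext s2) => [||z t Dz]; [exact: A1 | exact: submod_act |].
by rewrite AB // !ip_actl // AB.
Qed.

Lemma adjointD D1 D2 A B x y : submod D1 -> submod D2 ->
  adjoint D1 D2 A B -> D1 x -> D1 y -> A (x + y) = A x + A y.
Proof.
by move=> s1 s2 AB Dx Dy; rewrite -(scale1r x) (adjoint_lin _ s1 s2 AB) // !scale1r.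
Qed.

End HilbertModule.

(** * A complemented copy of the restricted module *)

Section Absorption.
Variables (R : realType) (X : topologicalType) (M : lmodType R[i]).
Variables (act : (X -> R[i]) -> M -> M) (ip : M -> M -> X -> R[i]).
Hypothesis H : hilbert_C0_module act ip.
Variables (U : set X) (p : nat -> X -> R).
Hypotheses (pU : forall n, cutoff U (p n)) (p0 : forall t, p 0%N t = 0)
  (pS : forall n t, p n t <= p n.+1 t) (p1 : forall n t, p n t <= 1)
  (pC : forall C, compact C -> C `<=` U ->
     exists N, forall n t, (N <= n)%N -> C t -> p n t = 1).
Implicit Types (x y z b c : M) (t : X) (e : R).

Definition supported x := forall t, ~ U t -> ip x x t = 0.

Lemma submod_supported : submod act supported.
Proof.
split=> [a x y Vx Vy t Ut|f x cf Vx t Ut].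
  by rewrite (ipDr H) !(ipDl H) !(ipZl H) !(ipZr H) Vx // Vy //
    (ip_eq0 H _ (Vx t Ut)) (ip_eq0 H _ (Vy t Ut)) !(mulr0, addr0).
by rewrite (ip_actl H) // (ip_actr H) // Vx // mul0r mulr0.
Qed.

Lemma supported_act f x : C0_on U f -> supported (act f x).
Proof. by move=> [cf fU] t Ut; rewrite (ip_actr H) // fU // mulr0. Qed.

Lemma supported_lim (u : nat -> M) l :
  (forall n, supported (u n)) -> lim_to ip u l -> supported l.
Proof.
move=> uV ul t Ut; apply: (ip_lim H ul); exists 0%N => n _.
exact: (ip_eq0 H _ (uV n t Ut)).
Qed.

Lemma supported0 : supported 0.
Proof. by move=> t _; rewrite (ip0r H). Qed.

Lemma supportedD x y : supported x -> supported y -> supported (x + y).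
Proof. by move=> Vx Vy; rewrite -(scale1r x); exact: (submod_lin submod_supported). Qed.

(** For supported [x], the error of [p_N x] is [(1 - p_N)^2 <x, x>]: zero where [p_N = 1], small
    elsewhere. Conversely, off [U] the approximating sums have norm 0, so [<x, x>] is below every
    [e] there. *)
Lemma supportedP x : supported x <-> in_restr act ip U x.
Proof.
split=> [Vx e e0|Rx t Ut].
  have [N xN] := C0_on_small pC (conj (hm_ip_C0 H x x) Vx) e0.
  have CpN := C0_cutoff (pU N); have [cpN _] := CpN; exists [:: (fun t => (p N t)%:C, x)].
  split=> [q [<-|//] //|t]; rewrite big_seq1 /=.
  rewrite -/(sqnorm ip _ t) (sqnormB H) (ip_actr H _ _ _ cpN).
  have -> : sqnorm ip (act (fun t => (p N t)%:C) x) t = p N t ^+ 2 * sqnorm ip x t.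
    apply: complexI; rewrite (sqnorm_act H _ _ cpN) sqr_normc conjc_real.
    by rewrite -!(rmorphM (real_complex R)) expr2.
  rewrite (ip_sqnorm H) -(rmorphM (real_complex R)) /=.
  have q0 := sqnorm_ge0 H x t; have pN1 := p1 N t.
  have [_ /(_ t) pN0 _ _] := pU N.
  have [/xN/(_) xe|p1'] := ltP (p N t) 1; last first.
    have -> : p N t = 1 by lra.
    by rewrite expr1n; lra.
  have {}xe : sqnorm ip x t < e by exact: xe.
  have : (1 - p N t) ^+ 2 * sqnorm ip x t <= sqnorm ip x t.
    rewrite -[leRHS]mul1r; apply: ler_wpM2r => //.
    by rewrite expr_le1 //; lra.
  by rewrite sqrrB expr1n; lra.
rewrite (ip_sqnorm H); suff -> : sqnorm ip x t = 0 by [].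
apply/le_anti; rewrite (sqnorm_ge0 H) andbT; apply/ler_addgt0Pl => e e0; rewrite addr0.
have [|s [sU xs]] := Rx (e / 2); first by rewrite divr_gt0.
set y := \sum_(q <- s) _ in xs.
have Vy : supported y.
  rewrite /y; elim: s sU {xs y} => [|q s IH] sU; rewrite ?big_nil ?big_cons.
    exact: supported0.
  apply: supportedD; last by apply: IH => r rs; apply: sU; right.
  by apply: supported_act; apply: sU; left.
have := sqnormD_le H (x - y) y t; rewrite subrK.
have := xs t; rewrite -/(sqnorm ip _ t).
have -> : sqnorm ip y t = 0 by rewrite /sqnorm Vy.
by lra.
Qed.

Lemma p_mono n n' t : (n <= n')%N -> p n t <= p n' t.
Proof. by move=> /subnK <-; elim: (n' - n)%N => // k IH; exact: le_trans IH (pS _ _). Qed.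

Definition root_diff n : X -> R[i] := fun t => (Num.sqrt (p n.+1 t - p n t))%:C.
Local Notation f := root_diff.

Lemma C0_root_diff n : C0_on U (f n).
Proof.
apply: (C0_cutoff (v := fun t => Num.sqrt (p n.+1 t - p n t))).
have [[c1 _ u1 [L1 [cL1 z1]]] [c0 _ u0 [L0 [cL0 z0]]]] := (pU n.+1, pU n).
split=> [t|t|t Ut|].
- apply: (@continuous_comp _ _ _ (fun t => p n.+1 t - p n t) Num.sqrt).
    by apply: continuousB; [exact: c1 | exact: c0].
  exact: sqrt_continuous.
- exact: sqrtr_ge0.
- by rewrite u1 // u0 // subr0 sqrtr0.
- exists (L1 `|` L0); split; first exact: compactU.
  by move=> t /not_orP[n1 n0]; rewrite z1 // z0 // subr0 sqrtr0.
Qed.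

Let C0f n : C0 (f n) := (C0_root_diff n).1.

Lemma root_diff_sqr n t : f n t * f n t = (p n.+1 t - p n t)%:C.
Proof.
by rewrite /f -(rmorphM (real_complex R)) -expr2 sqr_sqrtr // subr_ge0.
Qed.

Lemma root_diff_conj n t : (f n t)^* = f n t.
Proof. exact: conjc_real. Qed.

Lemma sum_root_diff n n' t : (n <= n')%N ->
  \sum_(n <= i < n') f i t * f i t = (p n' t - p n t)%:C.
Proof.
move=> nn'; under eq_bigr do rewrite root_diff_sqr.
by rewrite -(rmorph_sum (real_complex R)) telescope_sumr.
Qed.

Lemma root_diff_eventually0 t : exists N, forall n, (N <= n)%N -> f n t = 0.
Proof.
have [Ut|Ut] := pselect (U t); last by exists 0%N => n _; apply: (C0_root_diff n).2.
have [|N pN] := pC (@compact_set1 _ t); first by move=> _ ->.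
by exists N => n Nn; rewrite /f !pN // ?subrr ?sqrtr0 //; exact: leqW.
Qed.

Variables E S : nat -> M -> M.
Hypothesis ES : forall n, adjoint ip supported supported (E n) (S n).
Hypothesis SE : forall n b, supported b -> S n (E n b) = b.
Hypothesis SE0 : forall n m b, n <> m -> supported b -> S n (E m b) = 0.

Definition Tpart n n' b := \sum_(n <= i < n') act (f i) (E i b).
Definition Spart n n' x := \sum_(n <= i < n') S i (act (f i) x).

Lemma supportedE n b : supported b -> supported (E n b).
Proof. by have [+ _ _] := ES n; apply. Qed.

Lemma supportedS n b : supported b -> supported (S n b).
Proof. by have [_ + _] := ES n; apply. Qed.

Lemma supported_sum (s : seq nat) (F : nat -> M) :
  (forall i, supported (F i)) -> supported (\sum_(i <- s) F i).
Proof.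
move=> VF; elim: s => [|i s IH]; rewrite ?big_nil ?big_cons; first exact: supported0.
exact: supportedD.
Qed.

Lemma TSpart n n' : adjoint ip supported (fun _ => True) (Tpart n n') (Spart n n').
Proof.
split=> // [y _|b y t Vb _].
  by apply: supported_sum => i; apply/supportedS/supported_act/C0_root_diff.
rewrite (ip_suml H) (ip_sumr H); apply: eq_bigr => i _.
have [_ _ <-] := ES i => //; last exact/supported_act/C0_root_diff.
by rewrite (ip_actl H) // (ip_actr H) // root_diff_conj mulrC.
Qed.

Lemma ip_term i j b c t : supported b -> supported c ->
  ip (act (f i) (E i c)) (act (f j) (E j b)) t =
  if i == j then f j t * f j t * ip c b t else 0.
Proof.
move=> Vb Vc; rewrite (ip_actl H) // (ip_actr H) // root_diff_conj.
have [_ _ ->] := ES i; [|exact: Vc|exact: supportedE].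
case: eqP => [->|ij]; first by rewrite SE //; ring.
by rewrite SE0 // (ip0r H) mul0r mulr0.
Qed.

(** Orthogonality of the ranges leaves the diagonal terms of the shorter range, and these telescope.
    Two different ranges are allowed so that one side can pass to the limit first. *)
Lemma ip_Tpart k k' n n' b c t : supported b -> supported c ->
  (k <= n)%N -> (n <= n')%N -> (n' <= k')%N ->
  ip (Tpart k k' c) (Tpart n n' b) t = (p n' t - p n t)%:C * ip c b t.
Proof.
move=> Vb Vc kn nn' nk'; rewrite (ip_sumr H) -sum_root_diff // mulr_suml.
rewrite !big_nat; apply: eq_bigr => j /andP[nj jn'].
rewrite (ip_suml H); under eq_bigr do rewrite ip_term //.
rewrite (bigD1_seq j) ?iota_uniq ?mem_index_iota //=; last first.
  by rewrite (leq_trans kn nj) (leq_trans jn' nk').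
by rewrite eqxx big1 ?addr0 // => i /negPf ->.
Qed.

Lemma sqnorm_Tpart n n' b t : supported b -> (n <= n')%N ->
  sqnorm ip (Tpart n n' b) t = (p n' t - p n t) * sqnorm ip b t.
Proof.
move=> Vb nn'; apply: complexI; rewrite -(ip_sqnorm H) ip_Tpart // (ip_sqnorm H).
by rewrite -(rmorphM (real_complex R)).
Qed.

Lemma diff_le1 n n' t : p n' t - p n t <= 1.
Proof. by have := p1 n' t; have [_ /(_ t) + _ _] := pU n; lra. Qed.

(** Where [p_n = 1] the later increments vanish; where [p_n < 1], [<b, b>] is already small. *)
Lemma Tpart_lim b : supported b -> exists l, lim_to ip (fun n => Tpart 0 n b) l.
Proof.
move=> Vb; apply: (cauchy_lim H) => e e0.
have [N bN] := C0_on_small pC (conj (hm_ip_C0 H b b) Vb) e0.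
exists N => n m Nn nm t.
rewrite /Tpart (big_cat_nat (leq0n n) nm) /= addrAC subrr add0r sqnorm_Tpart //.
have := p_mono t nm; have := p1 m t; have b0 := sqnorm_ge0 H b t.
have [/bN be|] := ltP (p n t) 1.
  move=> pm1 pnm; apply: le_trans (ltW (be _)) => //.
  rewrite -[leRHS]mul1r -/(sqnorm ip b t); apply: ler_wpM2r => //; exact: diff_le1.
move=> a1 a2 a3; have -> : p m t - p n t = 0 by apply/eqP; lra.
by rewrite mul0r ltW.
Qed.

(** For [b] the partial adjoint of [x], expanding [sqnorm (x - Tpart b) >= 0] gives
    [sqnorm x >= (2 - (p_n' - p_n)) sqnorm b], and the factor is at least 1. *)
Lemma sqnorm_Spart n n' x t : (n <= n')%N -> sqnorm ip (Spart n n' x) t <= sqnorm ip x t.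
Proof.
move=> nn'; set b := Spart n n' x.
have [_ /(_ x I) Vb TS] := TSpart n n'.
have := sqnorm_ge0 H (x - Tpart n n' b) t.
rewrite (sqnormB H) -(Re_ipC H) TS // -/b -/(sqnorm ip b t) sqnorm_Tpart //.
have : (p n' t - p n t) * sqnorm ip b t <= sqnorm ip b t.
  rewrite -[leRHS]mul1r; apply: ler_wpM2r; [exact: sqnorm_ge0 H _ _ | exact: diff_le1].
by lra.
Qed.

(** The elements on which the series for [T^*] converges are shown to form a closed submodule
    containing every generator, hence all of [M]. *)
Definition Scauchy x := forall e, 0 < e -> exists N, forall n m, (N <= n)%N ->
  (n <= m)%N -> forall t, sqnorm ip (Spart n m x) t <= e.

Let SpartD n n' x y : Spart n n' (x + y) = Spart n n' x + Spart n n' y.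
Proof.
exact: (adjointD H (submod_full act) submod_supported (adjointC H (TSpart n n')) I I).
Qed.

Lemma ScauchyD x y : Scauchy x -> Scauchy y -> Scauchy (x + y).
Proof.
move=> Sx Sy e e0; have e4 : 0 < e / 4 by rewrite divr_gt0.
have [[N xN] [N' yN]] := (Sx _ e4, Sy _ e4); exists (maxn N N') => n m.
rewrite geq_max => /andP[Nn Nn'] nm t; rewrite SpartD.
have := sqnormD_le H (Spart n m x) (Spart n m y) t.
by have := xN n m Nn nm t; have := yN n m Nn' nm t; lra.
Qed.

Lemma Scauchy_act h x : C0 h -> Scauchy x -> Scauchy (act h x).
Proof.
move=> ch Sx e e0; have [B B0 hB] := C0_bounded ch.
have [N xN] := Sx (e / B) (divr_gt0 e0 B0); exists N => n m Nn nm t.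
rewrite (adjoint_act H (submod_full act) submod_supported (adjointC H (TSpart n m)) ch I).
rewrite -lecR (sqnorm_act H) //.
have s0 := sqnorm_ge0 H (Spart n m x) t.
apply: le_trans (_ : B%:C * (sqnorm ip (Spart n m x) t)%:C <= _).
  by apply: ler_wpM2r; rewrite ?hB // (lecR 0).
rewrite -(rmorphM (real_complex R)) lecR mulrC -ler_pdivlMr //; exact: xN.
Qed.

Lemma Scauchy_closed x :
  (forall e, 0 < e -> exists y, Scauchy y /\ forall t, sqnorm ip (x - y) t <= e) ->
  Scauchy x.
Proof.
move=> xy e e0; have e4 : 0 < e / 4 by rewrite divr_gt0.
have [y [Sy xye]] := xy _ e4; have [N yN] := Sy _ e4; exists N => n m Nn nm t.
rewrite -(subrK y x) SpartD.
have := sqnormD_le H (Spart n m (x - y)) (Spart n m y) t.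
by have := sqnorm_Spart (x - y) t nm; have := xye t; have := yN n m Nn nm t; lra.
Qed.

Variable g : nat -> M.
Hypothesis g_gen : forall x e, 0 < e -> exists s : seq ((X -> R[i]) * nat),
  (forall q, List.In q s -> C0 q.1) /\
  ip_small ip (x - \sum_(q <- s) act q.1 (g q.2)) e.
(** Stage [n] has to control only finitely many generators, yet each generator is controlled from
    some stage on. *)
Hypothesis g_decay : forall i n t, (i <= n)%N ->
  sqnorm ip (S n (act (f n) (g i))) t <= 4^-1 ^+ n.+1.

(* The factors [4^-1] absorb the doubling in [sqnormD_le]. *)
Lemma sqnorm_Spart_g i n k t : (i <= n)%N ->
  sqnorm ip (Spart n (n + k) (g i)) t <= 4^-1 ^+ n.
Proof.
elim: k n => [|k IH] n le_in.
  rewrite /Spart addn0 big_geq // /sqnorm (ip0r H) /=.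
  by rewrite exprn_ge0 // invr_ge0.
rewrite /Spart addnS -addSn big_ltn ?ltnS ?leq_addr // -/(Spart _ _ _).
have := sqnormD_le H (S n (act (f n) (g i))) (Spart n.+1 (n.+1 + k) (g i)) t.
have := g_decay t le_in; have := IH n.+1 (leqW le_in); rewrite !exprS.
set z := 4^-1 ^+ n; lra.
Qed.

Lemma Scauchy_all x : Scauchy x.
Proof.
have Sg i : Scauchy (g i).
  move=> e e0; have [N Ne] : exists N, forall n, (N <= n)%N -> 4^-1 ^+ n <= e.
    have : (GRing.exp (4^-1 : R) : R^nat) @ \oo --> (0 : R).
      by apply: cvg_expr; rewrite ger0_norm ?invr_ge0 // invf_lt1 // ltr1n.
    move=> /cvgrPdist_le/(_ e e0)[N _ Ne]; exists N => n /Ne /=.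
    by rewrite sub0r normrN; apply: le_trans; exact: ler_norm.
  exists (maxn N i) => n m; rewrite geq_max => /andP[Nn le_in] /subnKC <- t.
  exact: le_trans (sqnorm_Spart_g _ _ le_in) (Ne n Nn).
apply: Scauchy_closed => e /(g_gen x)[s [cs xs]]; exists (\sum_(q <- s) act q.1 (g q.2)).
split=> //; elim: s cs {xs} => [_|q s IH cs].
  rewrite big_nil => e' e'0; exists 0%N => n m _ nm t.
  apply: le_trans (sqnorm_Spart _ _ nm) _.
  by rewrite /sqnorm (ip0r H) ltW.
rewrite big_cons; apply: ScauchyD; last by apply: IH => r rs; apply: cs; right.
by apply: Scauchy_act; [apply: cs; left | exact: Sg].
Qed.

Lemma Spart_lim x : exists l, lim_to ip (fun n => Spart 0 n x) l.
Proof.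
apply: (cauchy_lim H) => e /(Scauchy_all x)[N xN]; exists N => n m Nn nm t.
by rewrite /Spart (big_cat_nat (leq0n n) nm) /= addrAC subrr add0r; exact: xN.
Qed.

(** [T] and [S'] are the limits of the partial sums. Their adjointness is checked at each point, and
    [S' T = 1] follows from [<T c, T b> = lim p_n <c, b>]. *)
Lemma complemented_isometry : exists T S',
  adjoint ip supported (fun _ => True) T S' /\ forall b, supported b -> S' (T b) = b.
Proof.
have /choice[T TP] : forall b, exists l, supported b -> lim_to ip (fun n => Tpart 0 n b) l.
  move=> b; have [/Tpart_lim[l bl]|nV] := pselect (supported b); first by exists l.
  by exists 0.
have /choice[S' S'P] := Spart_lim.
have VS y : supported (S' y).
  by apply: (supported_lim _ (S'P y)) => n; have [_ + _] := TSpart 0 n; apply.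
have TS : adjoint ip supported (fun _ => True) T S'.
  split=> // b y t Vb _; have [N fN] := root_diff_eventually0 t.
  (* At this [t] the terms from [N] on vanish, so both limits are computed by the partial sum up to
     [N]. *)
  have tail n : (N <= n)%N -> ip (Tpart 0 n b) y t = ip (Tpart 0 N b) y t.
    move=> Nn; rewrite !(ip_suml H) (big_cat_nat (leq0n N) Nn) /=.
    rewrite [X in _ + X]big_nat [X in _ + X]big1 ?addr0 // => i /andP[Ni _].
    by rewrite (ip_actl H) // fN // conjc0 mul0r.
  rewrite (ip_lim H (v := ip (Tpart 0 N b) y t) (TP b Vb)); last by exists N.
  rewrite (hm_ip_sym H (S' y)); apply: (canRL (@conjcK _)); apply/esym.
  apply: (ip_lim H (S'P y)); exists N => n Nn.
  by rewrite -(tail n Nn) (hm_ip_sym H b); congr conjc; have [_ _ ->] := TSpart 0 n.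
exists T, S'; split=> // b Vb; have [TV _ TSe] := TS.
apply: (submod_ext H submod_supported) => // c t Vc.
rewrite (hm_ip_sym H c) -TSe // (hm_ip_sym H c b); congr conjc.
have lim_c n : ip (T c) (Tpart 0 n b) t = (p n t)%:C * ip c b t.
  apply: (ip_lim H (TP c Vc)); exists n => n' nn'.
  by rewrite ip_Tpart // p0 subr0.
rewrite (hm_ip_sym H (T b)); apply: (canLR (@conjcK _)).
apply: (ip_lim H (TP b Vb)).
(* Off [U] the [p_n] do not tend to 1, but [<c, b>] vanishes there. *)
have [Ut|Ut] := pselect (U t); last first.
  exists 0%N => n _; rewrite (hm_ip_sym H (T c)) lim_c (ip_eq0 H _ (Vc t Ut)) mulr0.
  by rewrite conjc0.
have [|N pN] := pC (@compact_set1 _ t); first by move=> _ ->.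
by exists N => n Nn; rewrite (hm_ip_sym H (T c)) lim_c pN // mul1r.
Qed.

End Absorption.

(** * Isometries of the sequence module *)

Lemma double_mono : {homo (fun j => j.*2) : i j / (i < j)%N}.
Proof. by move=> i j; rewrite ltn_double. Qed.

Lemma doubleS_mono : {homo (fun j => j.*2.+1) : i j / (i < j)%N}.
Proof. by move=> i j; rewrite ltnS ltn_double. Qed.

(* For fixed [d] these sequences have disjoint ranges as [n] varies. *)
Definition dyadic (d : nat -> nat) (n j : nat) : nat := 2 ^ n * (j + d n).*2.+1.

Lemma dyadic_mono d n : {homo dyadic d n : i j / (i < j)%N}.
Proof. by move=> i j ij; rewrite ltn_pmul2l ?expn_gt0 // ltnS ltn_double ltn_add2r. Qed.

Lemma dyadic_ge d n j : (d n <= dyadic d n j)%N.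
Proof.
apply: leq_trans (_ : (j + d n).*2.+1 <= _)%N; last by rewrite leq_pmull ?expn_gt0.
by rewrite -addnn; apply/leqW/leq_trans/leq_addr; exact: leq_addl.
Qed.

(** The 2-adic valuation of [dyadic d n j] is [n]. *)
Lemma dyadic_disjoint d n m i j : n <> m -> dyadic d n i <> dyadic d m j.
Proof.
have log2 k l : logn 2 (dyadic d k l) = k.
  rewrite lognM ?expn_gt0 // pfactorK // lognE /= dvdn2 /= odd_double.
  by rewrite addn0.
by move=> nm /(congr1 (logn 2)); rewrite !log2.
Qed.

(** * Transport of the reindexing isometries to the restricted module *)

Section Reindexed.
Variables (R : realType) (X : topologicalType) (M : lmodType R[i]).
Variables (act : (X -> R[i]) -> M -> M) (ip : M -> M -> X -> R[i]).
Hypothesis H : hilbert_C0_module act ip.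
Variables (U : set X) (Psi : (nat -> X -> R[i]) -> M) (Q : M -> nat -> X -> R[i]).
Local Notation supp := (supported ip U).
Hypotheses (PsiV : forall a, l2U U a -> supp (Psi a))
  (Psi_inj : forall a b, l2U U a -> l2U U b -> Psi a = Psi b -> a = b)
  (Psi_ip : forall a b t, l2U U a -> l2U U b -> l2_ip_is a b t (ip (Psi a) (Psi b) t))
  (Psi_lin : forall c a b, l2U U a -> l2U U b -> Psi (l2_lin c a b) = c *: Psi a + Psi b)
  (QU : forall m, supp m -> l2U U (Q m))
  (PsiQ : forall m, supp m -> Psi (Q m) = m).
Implicit Types (k l : nat -> nat) (m b : M).

Definition pushM k m := Psi (push k (Q m)).
Definition pullM k m := Psi (pull k (Q m)).

Lemma QPsi a : l2U U a -> Q (Psi a) = a.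
Proof. by move=> aU; apply: Psi_inj => //; [exact/QU/PsiV | exact/PsiQ/PsiV]. Qed.

Lemma adjoint_pushM k : {homo k : i j / (i < j)%N} ->
  adjoint ip supp supp (pushM k) (pullM k).
Proof.
move=> kk; split=> [m Vm|m Vm|b m t Vb Vm].
- exact/PsiV/(l2U_push kk)/QU.
- exact/PsiV/(l2U_pull kk)/QU.
have [Ub Um] := (QU Vb, QU Vm).
have := Psi_ip t (l2U_push kk Ub) Um; rewrite PsiQ // => /(l2_ip_push kk) h.
have := Psi_ip t Ub (l2U_pull kk Um); rewrite PsiQ // => h'.
exact: l2_ip_unique h h'.
Qed.

Lemma pullM_pushM k b : {homo k : i j / (i < j)%N} -> supp b -> pullM k (pushM k b) = b.
Proof.
by move=> kk Vb; rewrite /pullM QPsi ?pull_push ?PsiQ //; exact/(l2U_push kk)/QU.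
Qed.

Lemma pullM_pushM0 k l b : {homo l : i j / (i < j)%N} -> (forall i j, k i <> l j) ->
  supp b -> pullM k (pushM l b) = 0.
Proof.
move=> ll kl Vb; have bU := l2U_push ll (QU Vb).
have -> : pullM k (pushM l b) = Psi (fun _ => cst 0).
  by rewrite /pullM QPsi // pull_push_disjoint.
have zU : l2U U (fun _ => cst 0 : X -> R[i]).
  split=> [n|e e0]; first exact: C0_on0.
  exists 0%N => N1 N2 _ _ t; rewrite big1 ?lecR ?(lecR 0) ?ltW // => i _.
  by rewrite normr0 expr0n.
(* [Psi 0 = 0] comes from [Psi 0 = Psi 0 + Psi 0]. *)
have := Psi_lin 1 zU zU; rewrite scale1r.
have -> : l2_lin 1 (fun _ => cst 0) (fun _ => cst 0 : X -> R[i]) = fun _ => cst 0.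
  by apply/funext => n; apply/funext => t; rewrite /l2_lin mulr0 addr0.
by move=> /eqP; rewrite -subr_eq subrr => /eqP.
Qed.

Local Notation even := (fun j => j.*2).
Local Notation odd := (fun j => j.*2.+1).

Lemma pushM_even_odd b : supp b ->
  pushM even (pullM even b) + pushM odd (pullM odd b) = b.
Proof.
move=> Vb; have bU := QU Vb.
have eU := l2U_pull double_mono bU; have oU := l2U_pull doubleS_mono bU.
rewrite /pushM !QPsi // -[X in X + _]scale1r -Psi_lin ?push_even_odd ?PsiQ //.
  exact: l2U_push double_mono _.
exact: l2U_push doubleS_mono _.
Qed.

Lemma pullM_small m (e : R) : 0 < e -> supp m ->
  exists d, forall k t, {homo k : i j / (i < j)%N} -> (forall j, d <= k j)%N ->
    sqnorm ip (pullM k m) t <= e.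
Proof.
move=> e0 Vm; have [d dP] := l2_ip_pull_small e0 (QU Vm).
exists d => k t kk dk; apply: (dP k t _ kk dk).
by apply: Psi_ip; exact/(l2U_pull kk)/QU.
Qed.

End Reindexed.

(** * Absorption *)

Section Swindle.
Variables (R : realType) (X : topologicalType) (M : lmodType R[i]).
Variables (act : (X -> R[i]) -> M -> M) (ip : M -> M -> X -> R[i]).
Hypothesis H : hilbert_C0_module act ip.
Variables (V : M -> Prop) (T S E0 S0 E1 S1 : M -> M).
Hypotheses (sV : submod act V)
  (TS : adjoint ip V (fun _ => True) T S) (ST : forall v, V v -> S (T v) = v)
  (ES0 : adjoint ip V V E0 S0) (ES1 : adjoint ip V V E1 S1)
  (S0E0 : forall v, V v -> S0 (E0 v) = v) (S1E1 : forall v, V v -> S1 (E1 v) = v)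
  (S0E1 : forall v, V v -> S0 (E1 v) = 0) (S1E0 : forall v, V v -> S1 (E0 v) = 0)
  (E01 : forall v, V v -> E0 (S0 v) + E1 (S1 v) = v).
Implicit Types (m v : M).

Let sT : submod act (fun _ : M => True) := submod_full act.
Let ST' := adjointC H TS.
Let VS m : V (S m). Proof. by have [_ + _] := TS; apply. Qed.
Let VE0 v : V v -> V (E0 v). Proof. by have [+ _ _] := ES0; apply. Qed.
Let VE1 v : V v -> V (E1 v). Proof. by have [+ _ _] := ES1; apply. Qed.
Let ip_T v m t : V v -> ip (T v) m t = ip v (S m) t.
Proof. by have [_ _ +] := TS => /[apply]; apply. Qed.

Definition merge_with m v := E0 (S m) + E1 v.
Definition kerS m := m - T (S m).
(** In [M = ker S (+) T V], the kernel component is kept, while the coordinate [S m] moves to the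
    range of [E0], freeing the range of [E1] for [v]. *)
Definition glue m v := kerS m + T (merge_with m v).

Lemma V_merge m v : V v -> V (merge_with m v).
Proof.
move=> Vv; rewrite /merge_with -(scale1r (E0 _)); apply: (submod_lin sV).
  exact/VE0/VS.
exact: VE1.
Qed.

Lemma S_kerS m : S (kerS m) = 0.
Proof.
have := adjoint_lin H (-1) sT sV ST' (x := T (S m)) (y := m) I I.
by rewrite !scaleN1r ST // !(addrC (- _)) subrr.
Qed.

Let SD m m' : S (m + m') = S m + S m'.
Proof. exact: (adjointD H sT sV ST' I I). Qed.

Lemma S_glue m v : V v -> S (glue m v) = merge_with m v.
Proof. by move=> Vv; rewrite SD S_kerS add0r ST //; exact: V_merge. Qed.

Lemma S0_merge m v : V v -> S0 (merge_with m v) = S m.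
Proof.
move=> Vv; have [VSm V0 V1] := And3 (VS m) (VE0 (VS m)) (VE1 Vv).
by rewrite (adjointD H sV sV (adjointC H ES0) V0 V1) S0E0 // S0E1 // addr0.
Qed.

Lemma S1_merge m v : V v -> S1 (merge_with m v) = v.
Proof.
move=> Vv; have [VSm V0 V1] := And3 (VS m) (VE0 (VS m)) (VE1 Vv).
by rewrite (adjointD H sV sV (adjointC H ES1) V0 V1) S1E1 // S1E0 // add0r.
Qed.

Lemma glue_surj m : exists m0 v, V v /\ glue m0 v = m.
Proof.
have VSm := VS m.
have V0 : V (S0 (S m)) by have [_ + _] := ES0; apply.
(* The coordinate [S m] is split into its two halves: one stays in [M], the other becomes the new
   summand. *)
exists (kerS m + T (S0 (S m))), (S1 (S m)).
split; first by have [_ + _] := ES1; apply.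
have E : S (kerS m + T (S0 (S m))) = S0 (S m) by rewrite SD S_kerS add0r ST.
by rewrite /glue /merge_with {1}/kerS !E E01 // addrK subrK.
Qed.

Lemma glue_inj m m' v v' : V v -> V v' -> glue m v = glue m' v' -> m = m' /\ v = v'.
Proof.
move=> Vv Vv' eqg; have eqm : merge_with m v = merge_with m' v' by rewrite -!S_glue // eqg.
have eqS : S m = S m' by rewrite -(S0_merge m Vv) eqm S0_merge.
split; last by rewrite -(S1_merge m Vv) eqm S1_merge.
by move: eqg; rewrite /glue eqm /kerS eqS => /addIr/addIr.
Qed.

(** The range of [T] is orthogonal to [ker S]. The kernel parts lack [<S m, S m'>], which the [E0]
    half restores; the [E1] half contributes [<v, v'>]. *)
Lemma ip_glue m m' v v' t : V v -> V v' ->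
  ip (glue m v) (glue m' v') t = ip m m' t + ip v v' t.
Proof.
move=> Vv Vv'; have [Vm Vm'] := (V_merge m Vv, V_merge m' Vv').
have Tk x z : V z -> ip (T z) (kerS x) t = 0.
  by move=> Vz; rewrite ip_T // S_kerS (ip0r H).
have kT x z : V z -> ip (kerS x) (T z) t = 0.
  by move=> Vz; rewrite (hm_ip_sym H (T z)) Tk // conjc0.
have mm : ip (merge_with m v) (merge_with m' v') t = ip (S m) (S m') t + ip v v' t.
  rewrite {1}/merge_with (ipDl H).
  have [[_ _ ip0] [_ _ ip1]] := (ES0, ES1); have VSm := VS m.
  by rewrite ip0 // ip1 // S0_merge // S1_merge.
have kk : ip (kerS m) (kerS m') t = ip m m' t - ip (S m) (S m') t.
  rewrite {1}/kerS (ipBl H) Tk // subr0 (ipBr H); congr (_ - _).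
  by rewrite (hm_ip_sym H (T _) m) ip_T // -(hm_ip_sym H).
rewrite /glue (ipDr H) (ipDl H (kerS m) _ (kerS m')) (ipDl H (kerS m) _ (T _)).
rewrite Tk // kT // ip_T // ST // mm kk.
by ring.
Qed.

Lemma glue_lin (c : R[i]) m m' v v' : V v -> V v' ->
  glue (c *: m + m') (c *: v + v') = c *: glue m v + glue m' v'.
Proof.
move=> Vv Vv'; have [Vm Vm'] := (V_merge m Vv, V_merge m' Vv').
have Slin : S (c *: m + m') = c *: S m + S m' := adjoint_lin H c sT sV ST' I I.
have Tlin := adjoint_lin H c sV sT TS.
have -> : glue (c *: m + m') (c *: v + v') =
    kerS (c *: m + m') + T (c *: merge_with m v + merge_with m' v').
  congr (_ + T _); rewrite /merge_with Slin scalerDr addrACA.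
  by rewrite (adjoint_lin H c sV sV ES0) // (adjoint_lin H c sV sV ES1).
rewrite Tlin // /glue /kerS Slin Tlin // !scalerDr scalerN opprD.
by rewrite (addrACA (c *: m)) (addrACA (c *: m - _)).
Qed.

Lemma glue_act f m v : C0 f -> V v -> glue (act f m) (act f v) = act f (glue m v).
Proof.
move=> cf Vv; have Vm := V_merge m Vv.
have Sact : S (act f m) = act f (S m) := adjoint_act H sT sV ST' cf I.
have actD x z : act f (x + z) = act f x + act f z.
  by have := hm_act_lin H 1 x z cf; rewrite !scale1r.
have actB x z : act f (x - z) = act f x - act f z.
  by have := hm_act_lin H (-1) z x cf; rewrite !scaleN1r !(addrC (- _)).
have -> : glue (act f m) (act f v) = kerS (act f m) + T (act f (merge_with m v)).
  congr (_ + T _); rewrite /merge_with Sact actD.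
  by rewrite (adjoint_act H sV sV ES0 cf) // (adjoint_act H sV sV ES1 cf).
have Tact := adjoint_act H sV sT TS cf.
by rewrite Tact // /glue /kerS Sact Tact // actD actB.
Qed.

End Swindle.

Theorem theorem6p7 (R : realType) (X : topologicalType) (U : set X)
  (M : lmodType R[i]) (act : (X -> R[i]) -> M -> M) (ip : M -> M -> X -> R[i]) :
  hausdorff_space X -> locally_compact [set: X] ->
  open U ->
  (exists K : nat -> set X, (forall n, compact (K n)) /\ U = \bigcup_n K n) ->
  hilbert_C0_module act ip ->
  countably_generated act ip ->
  restr_iso_l2 act ip U ->
  sum_l2_iso act ip U.
Proof.
move=> hX lcX oU sU H [g g_gen] [Psi [PsiR [Psi_surj [Psi_inj [Psi_ip [Psi_lin Psi_act]]]]]].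
have [p [pU p0 pS p1 pC]] := approx_unit R hX lcX oU sU.
have suppP := supportedP H pU p1 pC.
pose supp := supported ip U.
have sV : submod act supp := submod_supported H U.
have PsiV a : l2U U a -> supp (Psi a) by move=> /PsiR/suppP.
(* [Q] inverts [Psi] on the restricted module; its values elsewhere are irrelevant. *)
have /choice[Q QP] : forall m, exists a, supp m -> l2U U a /\ Psi a = m.
  move=> m; have [Vm|nV] := pselect (supp m); last by exists (fun _ => cst 0).
  by have /suppP/Psi_surj[a] := Vm; exists a.
have QU m : supp m -> l2U U (Q m) by move=> /QP[].
have PsiQ m : supp m -> Psi (Q m) = m by move=> /QP[].
pose f := root_diff p.
have Vf n m : supp (act (f n) m) by apply: (supported_act H); exact: (C0_root_diff pU n).
(* The shift [d n] is the maximum of the bounds for [g_0, ..., g_n]; it is fixed before the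
   isometries [E n] are built from it. *)
have /choice[d dP] : forall n, exists d, forall i k t, (i <= n)%N ->
    {homo k : i j / (i < j)%N} -> (forall j, d <= k j)%N ->
    sqnorm ip (pullM Psi Q k (act (f n) (g i))) t <= 4^-1 ^+ n.+1.
  move=> n; have e0 : 0 < 4^-1 ^+ n.+1 :> R by rewrite exprn_gt0 // invr_gt0.
  have /choice[d dP] := fun i => pullM_small Psi_ip QU e0 (Vf n (g i)).
  exists (\max_(i < n.+1) d i)%N => i k t le_in kk dk; apply: dP => // j.
  apply: leq_trans (dk j); rewrite -ltnS in le_in.
  exact: (leq_bigmax (Ordinal le_in)).
pose E n := pushM Psi Q (dyadic d n); pose E' n := pullM Psi Q (dyadic d n).
have EE n : adjoint ip supp supp (E n) (E' n).
  exact (adjoint_pushM PsiV Psi_ip QU PsiQ (@dyadic_mono d n)).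
have EK n b : supp b -> E' n (E n b) = b.
  exact (pullM_pushM PsiV Psi_inj QU PsiQ (@dyadic_mono d n)).
have E0 n m b : n <> m -> supp b -> E' n (E m b) = 0.
  move=> nm.
  exact (pullM_pushM0 PsiV Psi_inj Psi_lin QU PsiQ (@dyadic_mono d m)
    (fun i j => @dyadic_disjoint d n m i j nm)).
have decay i n t : (i <= n)%N -> sqnorm ip (E' n (act (f n) (g i))) t <= 4^-1 ^+ n.+1.
  by move=> le_in; exact: dP le_in (@dyadic_mono d n) (dyadic_ge d n).
have [T [S [TS ST]]] :=
  complemented_isometry H pU p0 pS p1 pC EE EK E0 g_gen decay.
pose even j := j.*2; pose odd j := j.*2.+1.
pose Ee := pushM Psi Q even; pose Re := pullM Psi Q even.
pose Eo := pushM Psi Q odd; pose Ro := pullM Psi Q odd.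
have aE : adjoint ip supp supp Ee Re := adjoint_pushM PsiV Psi_ip QU PsiQ double_mono.
have aO : adjoint ip supp supp Eo Ro := adjoint_pushM PsiV Psi_ip QU PsiQ doubleS_mono.
have ReE b : supp b -> Re (Ee b) = b := pullM_pushM PsiV Psi_inj QU PsiQ double_mono.
have RoE b : supp b -> Ro (Eo b) = b := pullM_pushM PsiV Psi_inj QU PsiQ doubleS_mono.
have eo i j : even i <> odd j.
  by move=> /(congr1 ssrnat.odd); rewrite /= !odd_double.
have ReEo b : supp b -> Re (Eo b) = 0.
  exact (pullM_pushM0 PsiV Psi_inj Psi_lin QU PsiQ doubleS_mono eo).
have RoEe b : supp b -> Ro (Ee b) = 0.
  exact (pullM_pushM0 PsiV Psi_inj Psi_lin QU PsiQ double_mono (fun i j => nesym (eo j i))).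
have EReo : forall b, supp b -> Ee (Re b) + Eo (Ro b) = b.
  exact (pushM_even_odd PsiV Psi_inj Psi_lin QU PsiQ).
exists (fun m a => glue T S Ee Eo m (Psi a)).
split=> [m|]; last split=> [m m' a b aU bU|]; last split=> [m m' a b t aU bU|];
  last split=> [c m m' a b aU bU|h m a ch aU].
- have [m0 [v [Vv <-]]] := glue_surj H sV TS ST aE aO EReo m.
  by have /suppP/Psi_surj[a [aU <-]] := Vv; exists m0, a.
- have [Va Vb] := (PsiV _ aU, PsiV _ bU).
  case/(glue_inj H sV TS ST aE aO ReE RoE ReEo RoEe Va Vb) => -> ab.
  by split=> //; exact: Psi_inj.
- have [Va Vb] := (PsiV _ aU, PsiV _ bU).
  rewrite (ip_glue H sV TS ST aE aO ReE RoE ReEo RoEe _ _ _ Va Vb) addrC addKr.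
  exact: Psi_ip.
- by rewrite Psi_lin //; apply: (glue_lin H sV TS aE aO); exact: PsiV.
- by rewrite Psi_act //; apply: (glue_act H sV TS aE aO) => //; exact: PsiV.
Qed.
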